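(* For all integers $J\ge 0$ and $N\ge 0$: $$MO(-2,25J+11;25N+13)\equiv 0\pmod 5,\qquad MO(-2,25J+24;25N+22)\equiv 0\pmod 5;$$ for each $M\in\{0,1,2,5\}$, $$MO(-2,49J+23;49N+7M+11)\equiv 0\pmod 7;$$ and for each $M\in\{2,4,5,6\}$, $$MO(-2,49J+48;49N+7M+1)\equiv 0\pmod 7.$$
   Context: For an integer $a$ and a nonnegative integer $t$, define $MO(a,t;n)$ by the formal power series identity $$\sum_{n\ge 0}MO(a,t;n)\,q^n=\sum_{1\le n_1<n_2<\cdots<n_t}\frac{q^{n_1+n_2+\cdots+n_t}}{\prod_{k=1}^t(1+aq^{n_k}+q^{2n_k})},$$ where each factor $1/(1+aq^{m}+q^{2m})$ is expanded as a power series in $q$ with integer coefficients. *)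

(* Defs.v *)
From HB Require Import structures.
From mathcomp Require Import all_boot all_order all_algebra.
From mathcomp Require Import boolp classical_sets functions cardinality fsbigop.

Set Implicit Arguments.
Unset Strict Implicit.
Unset Printing Implicit Defensive.

Import Order.TTheory GRing.Theory Num.Theory.
Local Open Scope ring_scope.

(* Univariate formal power series, as sequences of coefficients. *)
Record fps (R : Type) := Fps { coefs : nat -> R }.

Section FpsRing.
Variable R : comNzRingType.
Implicit Types f g h : fps R.

HB.instance Definition _ := gen_eqMixin (fps R).
HB.instance Definition _ := gen_choiceMixin (fps R).

Lemma fpsP f g : coefs f =1 coefs g -> f = g.
Proof. by case: f g => [f] [g] /= /funext->. Qed.

Definition fps_zero : fps R := Fps (fun=> 0).
Definition fps_opp f : fps R := Fps (fun n => - coefs f n).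
Definition fps_add f g : fps R := Fps (fun n => coefs f n + coefs g n).

Definition fps_one : fps R := Fps (fun n => (n == 0%N)%:R).
Definition fps_mul f g : fps R :=
  Fps (fun n => \sum_(i < n.+1) coefs f i * coefs g (n - i)).

Fact fps_addA : associative fps_add.
Proof. by move=> f g h; apply: fpsP => n /=; rewrite addrA. Qed.
Fact fps_addC : commutative fps_add.
Proof. by move=> f g; apply: fpsP => n /=; rewrite addrC. Qed.
Fact fps_add0 : left_id fps_zero fps_add.
Proof. by move=> f; apply: fpsP => n /=; rewrite add0r. Qed.
Fact fps_addN : left_inverse fps_zero fps_opp fps_add.
Proof. by move=> f; apply: fpsP => n /=; rewrite addNr. Qed.

HB.instance Definition _ :=
  GRing.isZmodule.Build (fps R) fps_addA fps_addC fps_add0 fps_addN.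

Definition fps_trunc n f : {poly R} := \poly_(i < n) coefs f i.

Lemma coefs_mul_trunc n f g i :
  (i < n)%N -> coefs (fps_mul f g) i = (fps_trunc n f * fps_trunc n g)`_i.
Proof.
move=> ltin; rewrite coefM /=; apply: eq_bigr => j _.
have ltjn : (j < n)%N by apply: leq_ltn_trans ltin; rewrite -ltnS.
by rewrite !coef_poly ltjn (leq_ltn_trans (leq_subr _ _) ltin).
Qed.

Fact fps_mulC : commutative fps_mul.
Proof.
by move=> f g; apply: fpsP => n; rewrite !(@coefs_mul_trunc n.+1) // mulrC.
Qed.

Fact fps_mulA : associative fps_mul.
Proof.
move=> f g h; apply: fpsP => n.
have trM u v i : (i < n.+1)%N ->
    (fps_trunc n.+1 (fps_mul u v))`_i = (fps_trunc n.+1 u * fps_trunc n.+1 v)`_i.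
  by move=> lti; rewrite coef_poly lti (@coefs_mul_trunc n.+1).
rewrite !(@coefs_mul_trunc n.+1) //.
transitivity (fps_trunc n.+1 f * (fps_trunc n.+1 g * fps_trunc n.+1 h))`_n.
  by rewrite !coefM; apply: eq_bigr => i _; rewrite trM // ltnS leq_subr.
by rewrite mulrA !coefM; apply: eq_bigr => i _; rewrite trM.
Qed.

Fact fps_mul1 : left_id fps_one fps_mul.
Proof.
move=> f; apply: fpsP => n /=; rewrite big_ord_recl mul1r subn0.
by rewrite big1 ?addr0 // => i _; rewrite mul0r.
Qed.

Fact fps_mulD : left_distributive fps_mul fps_add.
Proof.
move=> f g h; apply: fpsP => n /=; rewrite -big_split /=.
by apply: eq_bigr => i _; rewrite mulrDl.
Qed.

Fact fps_one_neq0 : fps_one != 0.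
Proof.
by apply/eqP => /(congr1 (fun f => coefs f 0)) /eqP; rewrite /= oner_eq0.
Qed.

HB.instance Definition _ := GRing.Zmodule_isComNzRing.Build (fps R)
  fps_mulA fps_mulC fps_mul1 fps_mulD fps_one_neq0.

Definition fpsX : fps R := Fps (fun n => (n == 1)%:R).

Lemma coefs0 n : coefs (0 : fps R) n = 0. Proof. by []. Qed.
Lemma coefs1 n : coefs (1 : fps R) n = (n == 0%N)%:R. Proof. by []. Qed.
Lemma coefsD f g n : coefs (f + g) n = coefs f n + coefs g n.
Proof. by []. Qed.
Lemma coefsN f n : coefs (- f) n = - coefs f n. Proof. by []. Qed.
Lemma coefsM f g n :
  coefs (f * g) n = \sum_(i < n.+1) coefs f i * coefs g (n - i).
Proof. by []. Qed.

Lemma coefsXM f n : coefs (fpsX * f) n = if n is m.+1 then coefs f m else 0.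
Proof.
rewrite coefsM; case: n => [|n]; first by rewrite big_ord1 mul0r.
rewrite big_ord_recl mul0r add0r big_ord_recl mul1r subSS subn0.
by rewrite big1 ?addr0 // => i _; rewrite mul0r.
Qed.

Lemma coefsXnM k f n :
  coefs (fpsX ^+ k * f) n = if (k <= n)%N then coefs f (n - k) else 0.
Proof.
elim: k n => [|k IHk] n; first by rewrite mul1r subn0.
by rewrite exprS -mulrA coefsXM; case: n => [|n] //; rewrite IHk subSS.
Qed.

Lemma coefsXn k n : coefs (fpsX ^+ k) n = (n == k)%:R.
Proof.
rewrite -[fpsX ^+ k]mulr1 coefsXnM coefs1 subn_eq0.
by case: ltngtP.
Qed.

End FpsRing.

Arguments fpsX {R}.

Section FpsInverse.
Variable R : comUnitRingType.
Implicit Types f g : fps R.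

(* The list of the first n coefficients of 1/f, for f(0) invertible, from the
   recurrence f(0) g(n) = [n = 0] - \sum_(i < n) f(n - i) g(i). *)
Fixpoint fps_inv_seq f n : seq R :=
  if n is m.+1 then
    let s := fps_inv_seq f m in
    rcons s ((coefs f 0)^-1 *
      ((m == 0%N)%:R - \sum_(i < m) coefs f (m - i) * s`_i))
  else [::].

Definition fps_unit : {pred fps R} := fun f => coefs f 0 \is a GRing.unit.

Definition fps_inv f : fps R :=
  if f \in fps_unit then Fps (fun n => (fps_inv_seq f n.+1)`_n) else f.

Lemma size_fps_inv_seq f n : size (fps_inv_seq f n) = n.
Proof. by elim: n => //= n IHn; rewrite size_rcons IHn. Qed.

Lemma nth_fps_inv_seq f n i :
  (i < n)%N -> (fps_inv_seq f n)`_i = (fps_inv_seq f i.+1)`_i.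
Proof.
elim: n => // n IHn; rewrite ltnS leq_eqVlt => /predU1P[-> // | ltin].
by rewrite [LHS]/= nth_rcons size_fps_inv_seq ltin IHn.
Qed.

Fact fps_mulVr : {in fps_unit, left_inverse 1 fps_inv *%R}.
Proof.
move=> f Uf; rewrite /fps_inv Uf; apply: fpsP => n.
rewrite coefsM big_ord_recr subnn /= nth_rcons size_fps_inv_seq ltnn eqxx.
rewrite mulrAC mulVr // mul1r addrC.
set S := (X in _ - X + _); set S' := (X in _ + X = _).
suff -> : S' = S by rewrite subrK.
by apply: eq_bigr => i _; rewrite mulrC [in RHS]nth_fps_inv_seq.
Qed.

Fact fps_unitPl f g : g * f = 1 -> f \in fps_unit.
Proof.
move=> /(congr1 (fun h => coefs h 0)); rewrite coefsM big_ord1 subnn coefs1.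
by move=> gf1; apply/unitrPr; exists (coefs g 0); rewrite mulrC.
Qed.

Fact fps_inv_out : {in [predC fps_unit], fps_inv =1 id}.
Proof. by move=> f; rewrite inE /fps_inv => /negPf->. Qed.

HB.instance Definition _ := GRing.ComNzRing_hasMulInverse.Build (fps R)
  fps_mulVr fps_unitPl fps_inv_out.

End FpsInverse.

(* [path ltn 0 s] says that s lists integers 1 <= n_1 < n_2 < ... < n_t. *)
Definition MO_index (t : nat) : set (seq nat) :=
  [set s | size s = t /\ path ltn 0%N s]%classic.

Definition MO_term (a : int) (s : seq nat) : fps int :=
  fpsX ^+ sumn s / \prod_(m <- s) (1 + a%:~R * fpsX ^+ m + fpsX ^+ (2 * m)).

(* The infinite sum is taken coefficientwise.  The operator
   \sum_(i \in A) F i stands for 0 when F has infinite support on A; this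
   case never arises, see finite_MO_support. *)
Definition MO (a : int) (t n : nat) : int :=
  \sum_(s \in MO_index t) coefs (MO_term a s) n.

Lemma MO_denom_unit (a : int) (s : seq nat) : path ltn 0%N s ->
  (\prod_(m <- s) (1 + a%:~R * fpsX ^+ m + fpsX ^+ (2 * m)) : fps int)
    \is a GRing.unit.
Proof.
move=> s_inc; have s_gt0 : all (ltn 0) s.
  by apply: (order_path_min _ s_inc) => x y z /=; apply: ltn_trans.
elim: s s_gt0 {s_inc} => [|m s IHs] /=; first by rewrite big_nil unitr1.
case/andP=> m_gt0 s_gt0; rewrite big_cons unitrM {}IHs // andbT.
apply: (_ : coefs _ 0 \is a GRing.unit).
by rewrite !coefsD mulrC coefs1 coefsXnM coefsXn; case: m m_gt0.
Qed.

Lemma MO_term_small (a : int) (s : seq nat) (n : nat) :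
  (n < sumn s)%N -> coefs (MO_term a s) n = 0.
Proof. by rewrite ltnNge => /negPf lt_n_s; rewrite coefsXnM lt_n_s. Qed.

Lemma mem_sumn (s : seq nat) (m : nat) : m \in s -> (m <= sumn s)%N.
Proof.
elim: s => //= k s IHs; rewrite inE => /predU1P[-> | /IHs lems].
  exact: leq_addr.
exact: leq_trans lems (leq_addl _ _).
Qed.

Lemma MO_index_bounded (a : int) (t n b : nat) (s : seq nat) : (n <= b)%N ->
  MO_index t s -> coefs (MO_term a s) n != 0 ->
  exists2 u : t.-tuple 'I_b.+1, path ltn 0%N (map val u) & s = map val u.
Proof.
move=> lenb [sz_s s_inc] s_n0.
have les : all (geq b) s.
  apply/allP => m /mem_sumn lems; apply: leq_trans lenb; apply: leq_trans lems _.
  by rewrite leqNgt; apply: contraNN s_n0 => /MO_term_small->.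
have Ds : map val (map (@inord b) s) = s.
  rewrite -map_comp -[RHS]map_id; apply/eq_in_map => m /(allP les) lemb.
  exact: inordK.
have sz_u : size (map (@inord b) s) == t by rewrite size_map sz_s.
by exists (Tuple sz_u); rewrite /= Ds.
Qed.

Lemma finite_MO_support (a : int) (t n : nat) :
  finite_set (MO_index t `&` [set s | coefs (MO_term a s) n != 0])%classic.
Proof.
apply: (@sub_finite_set _ _
  ((fun u : t.-tuple 'I_n.+1 => map val u) @` setT)%classic).
  by move=> s [/MO_index_bounded su /(su a n n (leqnn n)) [u _ ->]]; exists u.
exact/finite_image/finite_finset.
Qed.

Lemma MO_bounded (a : int) (t n b : nat) : (n <= b)%N ->
  MO a t n = \sum_(u : t.-tuple 'I_b.+1 | path ltn 0%N (map val u))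
               coefs (MO_term a (map val u)) n.
Proof.
move=> lenb.
pose P (u : t.-tuple 'I_b.+1) := path ltn 0%N (map val u).
pose r := [seq map val (val u) | u <- enum P].
have inj_r : injective (fun u : t.-tuple 'I_b.+1 => map val (val u)).
  by move=> u v /(inj_map val_inj)/val_inj.
have r_idx s : s \in r -> MO_index t s.
  by case/mapP=> u; rewrite mem_enum => Pu ->; rewrite /MO_index /= size_map size_tuple.
rewrite /MO (fsbigE r).
- rewrite big_seq_cond (eq_bigl (fun s => s \in r)) => [|s]; last first.
    by apply: andb_idr => /r_idx sP; rewrite inE.
  by rewrite -big_seq big_map big_enum.
- by rewrite map_inj_uniq ?enum_uniq.
- by move=> s /= /r_idx.
move=> s ts; apply: contraNeq => /(MO_index_bounded lenb ts)[u Pu ->].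
by apply/mapP; exists u; rewrite ?mem_enum.
Qed.

(* Main.v *)
Require Import Defs.
From mathcomp Require Import all_boot all_order all_algebra.
From mathcomp Require Import fsbigop classical_sets.
From mathcomp Require Import zify ring.

(* Put E = \prod_(k >= 1) (1 - q^k).  Writing x = 2 - z - 1/z turns the product
   \prod_k ((1 - q^k)^2 + q^k x) into that of Jacobi's triple product identity;
   comparing the coefficients of x^t gives the Andrews-Rose formula
     E^3 \sum_n MO(-2,t;n) q^n
       = \sum_k (-1)^(k+t) (2k+1)/(2t+1) 'C(k+t, 2t) q^(k(k+1)/2).
   For p = 5, 7 and the given t, the right-hand side is, modulo p, supported on
   a single class of exponents modulo p^2.  As E^(p^2) = E(q^(p^2)) modulo p, it
   remains to see that E^(p^2-3) has no term in certain classes modulo p^2.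
   - p = 5: E^22 = E^2 E(q^5)^4.  The pentagonal number theorem and a reflection
     of Z[i] show that the terms of E^2 with exponent 5m+2 vanish unless 5 | m,
     so it suffices that E^4 = E E^3 has no exponent 4 mod 5.
   - p = 7: E^46 = E^4 E(q^7)^6.  Since E^4 is an eigenform with complex
     multiplication by Q(sqrt(-3)), its terms of exponent 7m+1 are -4 times its
     terms of exponent m, which leaves E^10 = E(q^7) E^3, and by Jacobi's
     identity E^3 only has exponents 0, 1, 3 mod 7. *)

Set Implicit Arguments.
Unset Strict Implicit.
Unset Printing Implicit Defensive.
Import GRing.Theory.
Local Open Scope ring_scope.

(** * A finite form of the triple product identity *)

Lemma triS n : 'C(n.+2, 2) = ('C(n.+1, 2) + n.+1)%N.
Proof. by rewrite binS bin1 addnC. Qed.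

Section QSeries.
Variables (R : comNzRingType) (q : R).

Definition qpoch n : R := \prod_(i < n) (1 - q ^+ i.+1).

Lemma qpochS n : qpoch n.+1 = qpoch n * (1 - q ^+ n.+1).
Proof. by rewrite /qpoch big_ord_recr. Qed.

(** Gaussian binomial coefficients, given by a q-Pascal rule so that they make sense in every
    commutative ring, without division. *)
Fixpoint qbin n k : R :=
  match n, k with
  | _, 0 => 1
  | 0, _.+1 => 0
  | n'.+1, k'.+1 => qbin n' k' + q ^+ k'.+1 * qbin n' k'.+1
  end.

Lemma qbin0 n : qbin n 0 = 1. Proof. by case: n. Qed.

Lemma qbinS n k : qbin n.+1 k.+1 = qbin n k + q ^+ k.+1 * qbin n k.+1.
Proof. by []. Qed.

Lemma qbin_small n k : (n < k)%N -> qbin n k = 0.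
Proof.
elim: n k => [|n IHn] [|k] //= ltnk.
by rewrite !IHn ?mulr0 ?addr0 //; apply: leqW.
Qed.

Lemma qbinn n : qbin n n = 1.
Proof. by elim: n => //= n ->; rewrite qbin_small ?mulr0 ?addr0. Qed.

Lemma qbinSr n k :
  (k <= n)%N -> qbin n.+1 k.+1 = q ^+ (n - k) * qbin n k + qbin n k.+1.
Proof.
elim: n k => [|n IHn] k lekn.
  by move: lekn; rewrite leqn0 => /eqP -> /=; ring.
have [->|ltkn] := eqVneq k n.+1.
  by rewrite subnn (@qbin_small n.+1 n.+2) // !qbinn; ring.
have {ltkn}lekn : (k <= n)%N by lia.
rewrite [LHS]qbinS [X in _ + _ * X]IHn // (qbinS n k).
case: k lekn => [|k] ltkn.
  by rewrite !qbin0 subn0 !exprS; ring.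
rewrite [X in X + _ = _](IHn k) ?(qbinS n k); last by lia.
have -> : (n.+1 - k.+1 = n - k)%N by lia.
have -> : q ^+ (n - k) = q ^+ (n - k.+1) * q.
  by rewrite -exprSr; congr (_ ^+ _); lia.
rewrite !exprS; ring.
Qed.

Arguments qbin : simpl never.

Lemma qbin_qpoch a b : qbin (a + b) a * qpoch a * qpoch b = qpoch (a + b).
Proof.
elim: {a b}(a + b)%N {-2}a {-2}b (erefl (a + b)%N) => [|n IHn] a b.
  case: a b => [|a] [|b] // _.
  by rewrite qbin0 /qpoch !big_ord0; ring.
case: a b => [|a] [|b] //.
- by move=> _; rewrite qbin0 /qpoch big_ord0 !mul1r.
- by move=> _; rewrite !addn0 qbinn /qpoch big_ord0 mul1r mulr1.
move=> En; rewrite addSn addnS qbinS (qpochS (a + b).+1).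
have E1 : qbin (a + b).+1 a * qpoch a * qpoch b.+1 = qpoch (a + b).+1.
  by rewrite -addnS IHn //; lia.
have E2 : qbin (a + b).+1 a.+1 * qpoch a.+1 * qpoch b = qpoch (a + b).+1.
  by rewrite -addSn IHn //; lia.
transitivity (qbin (a + b).+1 a * qpoch a * qpoch b.+1 * (1 - q ^+ a.+1)
    + qbin (a + b).+1 a.+1 * qpoch a.+1 * qpoch b * (1 - q ^+ b.+1) * q ^+ a.+1).
  rewrite !qpochS; ring.
have -> : q ^+ (a + b).+2 = q ^+ a.+1 * q ^+ b.+1.
  by rewrite -exprD; congr (_ ^+ _); lia.
rewrite E1 E2; ring.
Qed.

Lemma qbin_sym a b : qbin (a + b) a = qbin (a + b) b.
Proof.
elim: {a b}(a + b)%N {-2}a {-2}b (erefl (a + b)%N) => [|n IHn] a b.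
  by case: a b => [|a] [|b].
case: a b => [|a] [|b] //.
- by rewrite qbin0 qbinn.
- by rewrite addn0 qbin0 qbinn.
move=> En; rewrite addSn qbinS qbinSr; last by lia.
have -> : (a + b.+1 - b = a.+1)%N by lia.
rewrite (IHn a b.+1); last by lia.
by rewrite addnS -addSn (IHn a.+1 b); [ring|lia].
Qed.

(** Both q-Pascal rules are applied, one after the other. The row 2N+1 thus passes to the row 2N+3,
    as needed when two factors, one in z and one in 1/z, are added to the product. *)
Lemma qbin_double_step N k :
  (k <= N)%N -> qbin (2 * N.+1).+1 k.+2 =
    (1 + q ^+ (2 * N.+1)) * qbin (2 * N).+1 k.+1
    + q ^+ k.+2 * qbin (2 * N).+1 k.+2
    + q ^+ (2 * N.+1 - k.+1) * qbin (2 * N).+1 k.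
Proof.
move=> lekN; have -> : (2 * N.+1 = (2 * N).+2)%N by lia.
rewrite qbinSr; last by lia.
rewrite (qbinS _ k) (qbinS _ k.+1).
have -> : q ^+ (2 * N).+2 = q ^+ ((2 * N).+2 - k.+1) * q ^+ k.+1.
  by rewrite -exprD; congr (_ ^+ _); lia.
ring.
Qed.

Variable x : R.

(** The state holds the values at n and n-1. The initial -1 is the value at -1 that the recurrence
    forces. *)
Fixpoint cheb n : R * R :=
  if n is m.+1 then let: (u, v) := cheb m in ((2 - x) * u - v, u) else (1, -1).
(* With x = 2 - z - 1/z, this is z^n + z^(n-1) + ... + z^(-n). *)
Definition dirichlet n : R := (cheb n).1.

Lemma dirichlet0 : dirichlet 0 = 1. Proof. by []. Qed.

Lemma dirichlet1 : dirichlet 1 = 3 - x.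
Proof. by rewrite /dirichlet /=; ring. Qed.

Lemma dirichletSS n :
  dirichlet n.+2 = (2 - x) * dirichlet n.+1 - dirichlet n.
Proof. by rewrite /dirichlet /=; case: (cheb n). Qed.

(** The q-binomial theorem expands (1 - z) times the product of (1 - q^i z)(1 - q^i/z) for 1 <= i <=
    N, with Gaussian coefficients of row 2N+1. The terms in z^(-n) and z^(n+1) have opposite
    coefficients; pairing them and dividing by 1 - z gives this multiple of [dirichlet n]. *)
Definition jcoef N n : R :=
  if (n <= N)%N then (-1) ^+ n * q ^+ 'C(n.+1, 2) * qbin (2 * N).+1 (N - n)
  else 0.

(** The boundary case: (z + 1/z) [dirichlet 0] is [dirichlet 1 - dirichlet 0], whence the difference
    in the last term. *)
Lemma jcoefS0 N : jcoef N.+1 0 =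
  (1 + q ^+ (2 * N.+1)) * jcoef N 0 - q ^+ N.+1 * (jcoef N 1 - jcoef N 0).
Proof.
rewrite /jcoef /= !subn0 bin_small // binn !mul1r expr1.
case: N => [|N].
  have -> : qbin (2 * 1).+1 1 = 1 + q + q ^+ 2.
    by rewrite !qbinS !qbin0 qbin_small //; ring.
  rewrite muln0 qbin0 muln1 ltnn; ring.
rewrite ltn0Sn subn1 /= qbin_double_step //.
have -> : (2 * N.+2 - N.+1 = N.+3)%N by lia.
have -> : qbin (2 * N.+1).+1 N.+2 = qbin (2 * N.+1).+1 N.+1.
  have -> : ((2 * N.+1).+1 = N.+2 + N.+1)%N by lia.
  exact: qbin_sym.
rewrite [q ^+ N.+3]exprSr [q ^+ N.+2]exprSr; ring.
Qed.

Lemma jcoefSS N n : jcoef N.+1 n.+1 =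
  (1 + q ^+ (2 * N.+1)) * jcoef N n.+1 - q ^+ N.+1 * (jcoef N n.+2 + jcoef N n).
Proof.
rewrite /jcoef ltnS.
have [leNn|ltNn|->] := ltngtP n N; last 1 first.
- rewrite (_ : (N.+1 < N)%N = false) ?subnn ?qbin0; last by lia.
  rewrite triS (exprD q 'C(N.+1, 2)) (exprS (-1)); ring.
- rewrite subSS.
  have [ltnN|lenN|eqnN] := ltngtP n.+1 N; last 1 first.
  + rewrite -eqnN subnn subSn // subnn !qbin0.
    have -> : ((2 * n.+2).+1 = (2 * n.+1).+3)%N by lia.
    rewrite qbinSr // qbin0 (qbinS _ 0) !qbin0 subn0.
    have -> : (2 * n.+2 = (2 * n.+1).+2)%N by lia.
    rewrite (triS n) (exprD q 'C(n.+1, 2)) !(exprS (-1)).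
    rewrite (exprS q n.+1); ring.
  + have -> : (N - n = (N - n.+2).+2)%N by lia.
    have -> : (N - n.+1 = (N - n.+2).+1)%N by lia.
    rewrite qbin_double_step; last by lia.
    rewrite (triS n.+1) (triS n) (exprD q ('C(n.+1, 2) + n.+1)).
    rewrite (exprD q 'C(n.+1, 2)).
    have -> : (2 * N.+1 - (N - n.+2).+1 = N.+1 + n.+2)%N by lia.
    have -> : N.+1 = ((N - n.+2).+2 + n.+1)%N by lia.
    rewrite !(exprD q) !(exprS (-1)); ring.
  + by exfalso; lia.
- by rewrite (_ : (n.+1 < N)%N = false); [ring|lia].
Qed.

(** With Q = q^(N+1), the new factor is 1 + Q^2 - Q (z + 1/z), and for n > 0 multiplication by z +
    1/z sends [dirichlet n] to the sum of its two neighbours. Collecting terms gives the recurrences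
    [jcoefS0] and [jcoefSS]. *)
Lemma finite_triple_product N :
  \prod_(i < N) ((1 - q ^+ i.+1) ^+ 2 + q ^+ i.+1 * x) =
  \sum_(n < N.+1) jcoef N n * dirichlet n.
Proof.
elim: N => [|N IHN].
  by rewrite big_ord0 big_ord1 /jcoef dirichlet0 bin_small //= qbin0 !mulr1 expr0.
rewrite big_ord_recr /= {}IHN.
have ext m K : (m < K)%N -> \sum_(n < m.+1) jcoef m n * dirichlet n =
    \sum_(n < K) jcoef m n * dirichlet n.
  move=> ltmK; rewrite (big_ord_widen K (fun n => jcoef m n * dirichlet n)) //.
  rewrite [in RHS](bigID (fun n : 'I_K => n < m.+1)%N) /= [X in _ + X]big1 ?addr0 //.
  by move=> i; rewrite /jcoef ltnS => /negPf->; rewrite mul0r.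
have recl (F : nat -> R) n : \sum_(i < n.+1) F i = F 0 + \sum_(i < n) F i.+1.
  by rewrite big_ord_recl.
rewrite [RHS](recl (fun n => jcoef N.+1 n * dirichlet n)) jcoefS0 dirichlet0.
rewrite [in RHS](eq_bigr (fun i : 'I_N.+1 =>
    (1 + q ^+ (2 * N.+1)) * (jcoef N i.+1 * dirichlet i.+1)
    - q ^+ N.+1 * (jcoef N i.+2 * dirichlet i.+1 + jcoef N i * dirichlet i.+1)));
  last by move=> i _; rewrite jcoefSS; ring.
rewrite sumrB -!mulr_sumr big_split /=.
have -> : \sum_(i < N.+1) jcoef N i.+1 * dirichlet i.+1 =
    \sum_(n < N.+1) jcoef N n * dirichlet n - jcoef N 0.
  rewrite (ext N N.+2) // [in RHS](recl (fun n => jcoef N n * dirichlet n)).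
  by rewrite dirichlet0; ring.
have -> : \sum_(i < N.+1) jcoef N i.+2 * dirichlet i.+1 =
    \sum_(i < N) jcoef N i.+1 * dirichlet i - jcoef N 1.
  have -> : \sum_(i < N) jcoef N i.+1 * dirichlet i =
      \sum_(i < N.+2) jcoef N i.+1 * dirichlet i.
    by rewrite !big_ord_recr /= /jcoef ltnn ltnNge leqnSn /= !mul0r !addr0.
  by rewrite (recl (fun n => jcoef N n.+1 * dirichlet n)) dirichlet0; ring.
rewrite (recl (fun n => jcoef N n * dirichlet n.+1)).
rewrite (recl (fun n => jcoef N n * dirichlet n)) dirichlet1 dirichlet0.
have -> : \sum_(i < N) jcoef N i.+1 * dirichlet i.+2 =
    (2 - x) * \sum_(i < N) jcoef N i.+1 * dirichlet i.+1
    - \sum_(i < N) jcoef N i.+1 * dirichlet i.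
  rewrite mulr_sumr -sumrB; apply: eq_bigr => i _.
  by rewrite dirichletSS; ring.
rewrite mul2n -addnn exprD; ring.
Qed.

End QSeries.

(** * The Andrews-Rose formula *)

Section Truncation.
Variable R : comUnitRingType.
Implicit Types f g h : fps R.

(** Congruence modulo q^n. It replaces limits: infinite products and sums are compared with finite
    ones. *)
Definition eq_upto n f g := forall i, (i < n)%N -> coefs f i = coefs g i.

Lemma eq_upto_refl n f : eq_upto n f f. Proof. by []. Qed.

Lemma eq_upto_sym n f g : eq_upto n f g -> eq_upto n g f.
Proof. by move=> fg i ltin; rewrite fg. Qed.

Lemma eq_upto_trans n g f h : eq_upto n f g -> eq_upto n g h -> eq_upto n f h.
Proof. by move=> fg gh i ltin; rewrite fg ?gh. Qed.

Lemma eq_upto_le m n f g : (m <= n)%N -> eq_upto n f g -> eq_upto m f g.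
Proof. by move=> lemn fg i ltim; rewrite fg // (leq_trans ltim). Qed.

Lemma eq_uptoD n f f' g g' :
  eq_upto n f f' -> eq_upto n g g' -> eq_upto n (f + g) (f' + g').
Proof. by move=> ff' gg' i ltin; rewrite !coefsD ff' ?gg'. Qed.

Lemma eq_uptoM n f f' g g' :
  eq_upto n f f' -> eq_upto n g g' -> eq_upto n (f * g) (f' * g').
Proof.
move=> ff' gg' i ltin; rewrite !coefsM; apply: eq_bigr => j _.
have lejn : (j < n)%N by rewrite (leq_ltn_trans _ ltin) // -ltnS.
by rewrite ff' // gg' // (leq_ltn_trans (leq_subr _ _)).
Qed.

Lemma eq_uptoX n f g k : eq_upto n f g -> eq_upto n (f ^+ k) (g ^+ k).
Proof.
by move=> fg; elim: k => // k IHk; rewrite !exprS; apply: eq_uptoM.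
Qed.

Lemma eq_upto_sum n (I : Type) (r : seq I) (F G : I -> fps R) :
  (forall i, eq_upto n (F i) (G i)) ->
  eq_upto n (\sum_(i <- r) F i) (\sum_(i <- r) G i).
Proof. by move=> FG; elim/big_rec2: _ => // i x y _; apply: eq_uptoD. Qed.

Lemma eq_upto_shift n k f g :
  eq_upto n f g -> eq_upto (k + n) (fpsX ^+ k * f) (fpsX ^+ k * g).
Proof.
move=> fg i ltin; rewrite !coefsXnM; case: leqP => // leki.
by rewrite fg // ltn_subLR.
Qed.

Lemma eq_upto_Xn0 n k f : (n <= k)%N -> eq_upto n (fpsX ^+ k * f) 0.
Proof. by move=> lenk i ltin; rewrite coefsXnM leqNgt (leq_trans ltin). Qed.

Lemma eq_upto_mulI n u f g :
  u \is a GRing.unit -> eq_upto n (u * f) (u * g) -> eq_upto n f g.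
Proof.
move=> Uu /(eq_uptoM (eq_upto_refl (u^-1) : eq_upto n _ _)).
by rewrite !mulKr.
Qed.

Lemma unit_fps f : (f \is a GRing.unit) = (coefs f 0 \is a GRing.unit).
Proof. by []. Qed.

Lemma coefs_sum n (I : Type) (r : seq I) (P : pred I) (F : I -> fps R) :
  coefs (\sum_(i <- r | P i) F i) n = \sum_(i <- r | P i) coefs (F i) n.
Proof. by elim/big_rec2: _ => // i x y _ <-. Qed.

End Truncation.

Lemma coefs_intrM (z : int) (f : fps int) n : coefs (z%:~R * f) n = z * coefs f n.
Proof.
have N (u : nat) : coefs (u%:R * f) n = u%:Z * coefs f n.
  elim: u => [|u IHu]; first by rewrite !mul0r.
  by rewrite -addn1 natrD PoszD !mulrDl coefsD IHu !mul1r.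
case: z => u; first exact: N.
by rewrite NegzE rmorphN !mulNr coefsN; congr (- _); apply: N.
Qed.

Lemma qpoch_upto (R : comUnitRingType) m n : (m <= n)%N ->
  eq_upto m.+1 (qpoch (fpsX : fps R) n) (qpoch fpsX m).
Proof.
elim: n => [|n IHn]; first by rewrite leqn0 => /eqP->.
rewrite leq_eqVlt => /predU1P[-> //|]; rewrite ltnS => lemn.
apply: eq_upto_trans (IHn lemn).
rewrite qpochS mulrBr mulr1 => i ltim; rewrite coefsD coefsN mulrC.
by rewrite (eq_upto_Xn0 _ (leqnn n.+1)) ?oppr0 ?addr0 // (leq_trans ltim).
Qed.

Section Euler.
Variable R : comUnitRingType.

(** The infinite product E: factors 1 - q^k with k > n do not affect the coefficient of q^n. *)
Definition euler : fps R := Fps (fun n => coefs (qpoch fpsX n) n).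

Lemma euler_upto n : eq_upto n.+1 euler (qpoch fpsX n).
Proof. by move=> i; rewrite ltnS => /qpoch_upto/(_ i)->. Qed.

Lemma euler_unit : euler \is a GRing.unit.
Proof. by rewrite unit_fps /= /qpoch big_ord0 unitr1. Qed.

(** In [qbin_qpoch] all three q-factorials agree with E to the stated order, so the Gaussian
    coefficient agrees with 1/E. *)
Lemma qbin_upto N n : (n <= N)%N ->
  eq_upto (N - n).+1 (euler * qbin fpsX (2 * N).+1 (N - n)) 1.
Proof.
move=> lenN; apply: (eq_upto_mulI euler_unit); rewrite mulr1.
have up m : (N - n <= m)%N -> eq_upto (N - n).+1 euler (qpoch fpsX m).
  by move=> lem; apply: (eq_upto_le _ (@euler_upto m)).
have Em : (2 * N).+1 = (N - n + (N + n).+1)%N by lia.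
have := qbin_qpoch (fpsX : fps R) (N - n) (N + n).+1.
rewrite -Em mulrAC -mulrA mulrC => E.
rewrite mulrA; apply: (@eq_upto_trans _ _ (qpoch fpsX (2 * N).+1)); last first.
  by apply/eq_upto_sym/up; lia.
rewrite -E; apply: eq_uptoM => //; apply: eq_uptoM; apply: up; lia.
Qed.

(** The n orders of precision lost in [qbin_upto] are recovered from the factor q^(n(n+1)/2), as
    n(n+1)/2 >= n. *)
Lemma jcoef_upto N n : (n <= N)%N ->
  eq_upto N.+1 (euler * jcoef fpsX N n) ((-1) ^+ n * fpsX ^+ 'C(n.+1, 2)).
Proof.
move=> lenN; rewrite /jcoef lenN [X in eq_upto _ X _](_ : _ =
  (-1) ^+ n * (fpsX ^+ 'C(n.+1, 2) * (euler * qbin fpsX (2 * N).+1 (N - n))));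
  last by ring.
apply: eq_uptoM => //; rewrite -[X in eq_upto _ _ X]mulr1.
apply: eq_upto_le _ (eq_upto_shift (qbin_upto lenN)).
suff : (n <= 'C(n.+1, 2))%N by lia.
by elim: n {lenN} => // n IHn; rewrite triS; lia.
Qed.

End Euler.

(* The coefficient of x^t in dirichlet x n; it equals
   (-1)^t (2n+1)/(2t+1) 'C(n + t, 2t). *)
Definition dircoef n t : int :=
  (-1) ^+ t * ('C(n + t + 1, 2 * t + 1) + 'C(n + t, 2 * t + 1))%N%:R.

Lemma dircoef_bin n t :
  (2 * t + 1)%:R * dircoef n t = (-1) ^+ t * (2 * n + 1)%:R * 'C(n + t, 2 * t)%:R.
Proof.
rewrite /dircoef mulrCA -mulrA -!natrM; congr (_ * _%:R).
rewrite mulnDr !addn1 -mul_bin_diag /= mul_bin_left.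
have [le_tn|ltnt] := leqP t n; last by rewrite bin_small ?muln0 //; lia.
rewrite -mulnDl; congr (_ * _)%N; lia.
Qed.

Lemma dircoefSS n t : dircoef n.+2 t =
  2 * dircoef n.+1 t - (if t is t'.+1 then dircoef n.+1 t' else 0) - dircoef n t.
Proof.
rewrite /dircoef; case: t => [|t]; first by rewrite !addn0 !addn1 !bin1; ring.
(* The second difference of a binomial coefficient in its upper index lowers the lower index by
   2. *)
have E m k : ('C(m.+2, k.+2) + 'C(m, k.+2) =
    2 * 'C(m.+1, k.+2) + 'C(m, k))%N by rewrite !binS; lia.
have -> : (2 * t.+1 + 1 = (2 * t + 1).+2)%N by lia.
move: (2 * t + 1)%N => k; rewrite !addn1 !addSn !addnS.
have := E (n + t).+1 k; have := E (n + t).+2 k.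
move: 'C(_, _) 'C(_, _) 'C(_, _) 'C(_, _) => b1 b2 b3 b4.
move: 'C(_, _) 'C(_, _) => b5 b6 E1 E2.
rewrite exprS mulN1r -signr_odd; case: (odd t) => /=; lia.
Qed.

Lemma coef_dirichlet (R : comNzRingType) n t :
  (dirichlet ('X : {poly R}) n)`_t = (dircoef n t)%:~R.
Proof.
elim/ltn_ind: n t => -[|[|n]] IHn t.
- rewrite dirichlet0 coef1 /dircoef add0n.
  case: t => [|t]; first by rewrite mul1r.
  by rewrite !bin_small ?mulr0 //; lia.
- rewrite dirichlet1 -[3]/(3%:R) -polyC_natr coefB coefX coefC /dircoef.
  case: t => [|[|t]].
  + by rewrite subr0.
  + by rewrite /= sub0r.
  by rewrite !bin_small /= ?subr0 ?mulr0 //; lia.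
rewrite dirichletSS mulrBl !coefB -[2]/(2%:R) -polyC_natr.
rewrite coefCM coefXM !IHn // dircoefSS !rmorphB (rmorphM _ 2) /=.
by case: t.
Qed.

Fixpoint subseqs (T : Type) t (s : seq T) : seq (seq T) :=
  match t, s with
  | 0, _ => [:: [::]]
  | _.+1, [::] => [::]
  | t'.+1, a :: s' => map (cons a) (subseqs t' s') ++ subseqs t s'
  end.

Lemma mem_subseqs (T : eqType) t (s r : seq T) :
  (r \in subseqs t s) = (size r == t) && subseq r s.
Proof.
elim: s t r => [|a s IHs] [|t] [|b r] //=.
- by rewrite andbF.
- by rewrite mem_cat IHs orbF; apply/mapP => -[].
rewrite mem_cat IHs /= eqSS; case: (b =P a) => [->|/eqP neq_ba].
  rewrite mem_map ?IHs; last by move=> ? ? [].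
  by case: eqP => //= _; apply/orb_idr/subseq_trans/subseq_cons.
by rewrite [X in X || _](_ : _ = false) //; apply/mapP => -[? _ [/eqP]]; rewrite (negPf neq_ba).
Qed.

Lemma subseqs_uniq (T : eqType) t (s : seq T) : uniq s -> uniq (subseqs t s).
Proof.
elim: s t => [|a s IHs] [|t] //= /andP[as_ s_uniq].
rewrite cat_uniq map_inj_uniq ?IHs //; last by move=> ? ? [].
rewrite andbT; apply/hasPn => r; rewrite mem_subseqs => /andP[_ rs].
apply/mapP => -[r' _ Er]; move: as_; rewrite (mem_subseq rs) //.
by rewrite Er mem_head.
Qed.

(** Elementary symmetric functions: each factor contributes either 1 or its term in 'X. *)
Lemma coef_prod_1DMX (R : comNzRingType) (g : nat -> R) s t :
  (\prod_(k <- s) (1 + (g k)%:P * 'X))`_t =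
  \sum_(r <- subseqs t s) \prod_(k <- r) g k.
Proof.
elim: s t => [|a s IHs] [|t].
- by rewrite big_nil coef1 /= big_seq1 big_nil.
- by rewrite big_nil coef1 /= big_nil.
- rewrite big_cons mulrDl mul1r coefD -mulrA coefCM mulrC coefXM /= mul0r addr0.
  by rewrite IHs; case: (s).
rewrite big_cons mulrDl mul1r coefD -mulrA coefCM coefXM /= big_cat big_map /=.
rewrite addrC !IHs; congr (_ + _); rewrite mulr_sumr.
by apply: eq_bigr => r _; rewrite big_cons.
Qed.

Section Rmorph.
Variables (R S : comNzRingType) (f : {rmorphism R -> S}) (q : R).

Lemma rmorph_qbin n k : f (qbin q n k) = qbin (f q) n k.
Proof.
elim: n k => [|n IHn] [|k]; rewrite ?qbin0 ?rmorph1 //; first exact: rmorph0.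
by rewrite !qbinS rmorphD rmorphM rmorphXn !IHn.
Qed.

Lemma rmorph_jcoef N n : f (jcoef q N n) = jcoef (f q) N n.
Proof.
rewrite /jcoef; case: leqP => _; last exact: rmorph0.
by rewrite !rmorphM !rmorphXn rmorphN1 rmorph_qbin.
Qed.

End Rmorph.

(** A term of index r starts at q^([sumn r]), so an index with an entry above N does not contribute
    to this order. *)
Lemma MO_upto a t N : eq_upto N.+1 (Fps (MO a t))
  (\sum_(r <- subseqs t (iota 1 N)) MO_term a r).
Proof.
move=> n; rewrite ltnS => lenN; rewrite coefs_sum /= /MO.
rewrite (fsbigE (subseqs t (iota 1 N))).
- rewrite big_seq_cond [RHS]big_seq; apply: eq_bigl => r; apply: andb_idr.
  rewrite mem_subseqs => /andP[/eqP sz_r sub_r]; rewrite inE; split=> //.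
  have: path ltn 0 (iota 1 N) by apply: (iota_ltn_sorted 0 N.+1).
  by apply: subseq_path => //; apply: ltn_trans.
- by apply/subseqs_uniq/iota_uniq.
- move=> r /=; rewrite mem_subseqs => /andP[/eqP sz_r sub_r]; split=> //.
  have: path ltn 0 (iota 1 N) by apply: (iota_ltn_sorted 0 N.+1).
  by apply: subseq_path => //; apply: ltn_trans.
move=> r [sz_r r_inc]; apply: contraNeq => rn0.
rewrite mem_subseqs sz_r eqxx /=.
have r_gt0 : all (ltn 0) r by apply: (order_path_min ltn_trans).
have -> : r = filter [in r] (iota 1 N).
  apply: (irr_sorted_eq ltn_trans ltnn); first exact: path_sorted r_inc.
    by apply: sorted_filter (iota_ltn_sorted 1 N); apply: ltn_trans.
  move=> m; rewrite mem_filter andb_idr // => mr.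
  rewrite mem_iota; apply/andP; split; first exact: (allP r_gt0).
  rewrite add1n ltnS; apply: leq_trans (mem_sumn mr) (leq_trans _ lenN).
  by rewrite leqNgt; apply: contraNN rn0 => /MO_term_small->.
exact: filter_subseq.
Qed.

Lemma subr1Xn_unit (R : comUnitRingType) k :
  (0 < k)%N -> 1 - fpsX ^+ k \is a @GRing.unit (fps R).
Proof.
case: k => // k _.
by rewrite unit_fps coefsD coefsN coefs1 coefsXn subr0 unitr1.
Qed.

(** For a = -2 each denominator is the square (1 - q^k)^2. *)
Lemma MO_term_prod (r : seq nat) : all (ltn 0) r ->
  MO_term (-2) r = \prod_(k <- r) (fpsX ^+ k / (1 - fpsX ^+ k) ^+ 2).
Proof.
have E k : 1 + (-2)%:~R * fpsX ^+ k + fpsX ^+ (2 * k) =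
    (1 - fpsX ^+ k) ^+ 2 :> fps int.
  by rewrite mulnC exprM rmorphN /=; ring.
rewrite /MO_term; under eq_bigr do rewrite E.
elim: r => [|k r IHr] /= => [_|/andP[k_gt0 r_gt0]].
  by rewrite !big_nil invr1 mulr1.
have Ur : \prod_(j <- r) (1 - fpsX ^+ j) ^+ 2 \is a @GRing.unit (fps int).
  elim: r r_gt0 {IHr} => [|j r IHr] /=; first by rewrite big_nil unitr1.
  by case/andP=> ? ?; rewrite big_cons unitrM unitrX ?subr1Xn_unit ?IHr.
rewrite !big_cons -IHr // exprD invrM ?unitrX ?subr1Xn_unit //; ring.
Qed.

Lemma andrews_rose t N :
  eq_upto N.+1 (euler int ^+ 3 * Fps (MO (-2) t))
    (\sum_(n < N.+1) ((-1) ^+ n * dircoef n t)%:~R * fpsX ^+ 'C(n.+1, 2)).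
Proof.
pose g k : fps int := fpsX ^+ k / (1 - fpsX ^+ k) ^+ 2.
have finite : qpoch fpsX N ^+ 2 * \sum_(r <- subseqs t (iota 1 N)) MO_term (-2) r
    = \sum_(n < N.+1) jcoef fpsX N n * (dircoef n t)%:~R.
  (* In [{poly fps int}] the indeterminate 'X plays x and q is a constant. Dividing each factor of
     the finite product by (1 - q^k)^2 leaves 1 + [g k] x, whose product is read at x^t. *)
  transitivity (\sum_(n < N.+1) jcoef fpsX%:P N n * dirichlet 'X n
      : {poly fps int})`_t; last first.
    rewrite coef_sum; apply: eq_bigr => n _.
    by rewrite -(rmorph_jcoef (@polyC (fps int))) coefCM coef_dirichlet.
  have -> : \sum_(r <- subseqs t (iota 1 N)) MO_term (-2) r =
      (\prod_(k <- iota 1 N) (1 + (g k)%:P * 'X))`_t.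
    rewrite coef_prod_1DMX big_seq [RHS]big_seq; apply: eq_bigr => r.
    rewrite mem_subseqs => /andP[_ sub_r]; apply: MO_term_prod.
    by apply/allP => k /(mem_subseq sub_r); rewrite mem_iota => /andP[].
  rewrite -finite_triple_product /qpoch -prodrXl -coefCM; congr ((_ : {poly _})`_t).
  rewrite -(big_mkord xpredT (fun i => (1 - fpsX ^+ i.+1) ^+ 2)) rmorph_prod.
  rewrite -(big_mkord xpredT (fun i =>
    (1 - fpsX%:P ^+ i.+1) ^+ 2 + fpsX%:P ^+ i.+1 * 'X)) /=.
  rewrite -[iota 1 N]/(iota (1 + 0) N) iotaDl big_map /index_iota subn0.
  rewrite -big_split /=; apply: eq_bigr => i _.
  rewrite add1n /g mulrDr mulr1 mulrA -polyCM.
  rewrite mulrCA mulrV ?unitrX ?subr1Xn_unit // mulr1.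
  by rewrite !rmorphXn rmorphB rmorph1 rmorphXn.
(* Two factors E match the squared q-factorial in [finite]; the third will clear the 1/E hidden in
   [jcoef]. *)
have up : eq_upto N.+1 (euler int ^+ 3 * Fps (MO (-2) t))
    (euler int * \sum_(n < N.+1) jcoef fpsX N n * (dircoef n t)%:~R).
  rewrite -finite exprS -mulrA; apply: eq_uptoM => //.
  by apply: eq_uptoM (@MO_upto _ _ _); apply/eq_uptoX/euler_upto.
apply: eq_upto_trans up _; rewrite mulr_sumr.
apply: eq_upto_sum => n; rewrite mulrA.
rewrite [X in eq_upto _ _ X](_ : _ =
  (-1) ^+ n * fpsX ^+ 'C(n.+1, 2) * (dircoef n t)%:~R); last first.
  by rewrite intrM rmorphXn rmorphN1 mulrAC.
by apply: eq_uptoM => //; apply: jcoef_upto; rewrite -ltnS.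
Qed.

(** The case t = 0 of [andrews_rose]: only the empty index remains, so the generating function is
    1. *)
Lemma jacobi N :
  eq_upto N.+1 (euler int ^+ 3)
    (\sum_(n < N.+1) ((-1) ^+ n * (2 * n + 1)%:R)%:~R * fpsX ^+ 'C(n.+1, 2)).
Proof.
have MO0 : Fps (MO (-2) 0) = 1.
  apply: fpsP => n; rewrite (@MO_upto (-2) 0 n n) //.
  have -> : subseqs 0 (iota 1 n) = [:: [::]] by case: n.
  by rewrite big_seq1 /MO_term big_nil invr1 mulr1 expr0.
have -> : euler int ^+ 3 = euler int ^+ 3 * Fps (MO (-2) 0) by rewrite MO0 mulr1.
apply: eq_upto_trans (@andrews_rose 0 N) _.
apply: eq_upto_sum => n; rewrite /dircoef !addn0 !addn1 !bin1 mul1r.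
have -> : (n.+1 + n = (2 * n).+1)%N by lia.
exact: eq_upto_refl.
Qed.

(** * The pentagonal number theorem *)

(** The sign (-1)^j for j of either sign, stated by divisibility so that [lia] can decide it. *)
Definition esgn (j : int) : int := if (2 %| j)%Z then 1 else -1.

Lemma esgn_nat (n : nat) : esgn n = (-1) ^+ n.
Proof. rewrite -signr_odd /esgn; case: ifP; case: (boolP (odd n)) => //=; lia. Qed.

Lemma esgnN j : esgn (- j) = esgn j.
Proof. by rewrite /esgn; do 2 case: ifP => //; lia. Qed.

Fixpoint zball n : seq int :=
  if n is m.+1 then n%:Z :: - n%:Z :: zball m else [:: 0].

Lemma mem_zball n j : (j \in zball n) = (`|j| <= n)%N.
Proof.
elim: n => [|n IHn] /=; first by rewrite inE; lia.
by rewrite !inE IHn; lia.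
Qed.

Lemma zball_uniq n : uniq (zball n).
Proof. by elim: n => //= n ->; rewrite inE !mem_zball; lia. Qed.

(** Generalized pentagonal numbers. The product j(3j+1) is never negative, so the absolute value
    only moves it to [nat]. *)
Definition pent (j : int) : nat := `|j * (3 * j + 1)|./2.
Definition tri (j : int) : nat := `|j * (j + 1)|./2.

Lemma pentE j : (2 * pent j)%:Z = j * (3 * j + 1).
Proof.
rewrite /pent; have : 0 <= j * (3 * j + 1) by nia.
suff : (2 %| j * (3 * j + 1))%Z by lia.
have [/dvdzP[k ->]|/dvdzP[k E]] : (2 %| j)%Z \/ (2 %| j + 1)%Z by lia.
  by rewrite -!mulrA mulrCA dvdz_mulr.
by rewrite (_ : 3 * j + 1 = (j + k) * 2) ?mulrA ?dvdz_mull //; lia.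
Qed.

Lemma triE j : (2 * tri j)%:Z = j * (j + 1).
Proof.
rewrite /tri; have : 0 <= j * (j + 1) by nia.
suff : (2 %| j * (j + 1))%Z by lia.
have [/dvdzP[k ->]|/dvdzP[k ->]] : (2 %| j)%Z \/ (2 %| j + 1)%Z by lia.
  by rewrite -mulrA mulrCA dvdz_mulr.
by rewrite mulrA dvdz_mull.
Qed.

Lemma bin2E n : (2 * 'C(n.+1, 2) = n * n.+1)%N.
Proof. by elim: n => // n IHn; rewrite triS; lia. Qed.

Lemma tri_nat (n : nat) : tri n = 'C(n.+1, 2).
Proof. by have := triE n; have := bin2E n; nia. Qed.

Section Shanks.
Variables (R : comNzRingType) (q : R).

Definition qprod s n : R := \prod_(s <= k < n) (1 - q ^+ k.+1).

(* Due to Shanks.  Modulo q^(n+1) only the term s = 0 of the left-hand side, a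
   partial product of E, survives. *)
Lemma shanks n :
  \sum_(s < n.+1) (-1) ^+ s * (qprod s n * q ^+ (s * n + 'C(s.+1, 2))) =
  \sum_(j <- zball n) (esgn j)%:~R * q ^+ pent j.
Proof.
elim: n => [|n IHn].
  by rewrite big_ord1 big_seq1 /qprod big_geq //= !mul1r.
rewrite big_ord_recr /= !big_cons -{}IHn.
pose B s := qprod s n * q ^+ (s * n + 'C(s.+1, 2)).
have E m : (m <= n)%N ->
    \sum_(s < m.+1) (-1) ^+ s * (qprod s n.+1 * q ^+ (s * n.+1 + 'C(s.+1, 2))) =
    \sum_(s < m.+1) (-1) ^+ s * B s - (-1) ^+ m * (q ^+ (n.+1 + m) * B m).
  elim: m => [|m IHm] lemn.
    rewrite !big_ord1 /B !mul0n !add0n /qprod big_nat_recr //= addn0; ring.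
  rewrite big_ord_recr /= IHm 1?ltnW // [in RHS]big_ord_recr /=.
  have -> : B m = (1 - q ^+ m.+1) * qprod m.+1 n * q ^+ (m * n + 'C(m.+1, 2)).
    by rewrite /B /qprod big_ltn.
  rewrite /B /qprod big_nat_recr //= -/(qprod _ _).
  have -> : (m.+1 * n.+1 + 'C(m.+2, 2) = m.+1 + n + m.+1 + (m * n + 'C(m.+1, 2)))%N.
    by rewrite triS; lia.
  have -> : (m.+1 * n + 'C(m.+2, 2) = n + m.+1 + (m * n + 'C(m.+1, 2)))%N.
    by rewrite triS; lia.
  move: (m * n + 'C(m.+1, 2))%N => c.
  rewrite (addSnnS n m) !(exprD q) (exprS (-1)) (exprS q n); ring.
rewrite {}E // /B /qprod !big_geq // !mul1r.
have -> : esgn n.+1 = (-1) ^+ n.+1 by rewrite esgn_nat.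
have -> : esgn (- (n.+1)%:Z) = (-1) ^+ n.+1 by rewrite esgnN esgn_nat.
have -> : pent n.+1 = (n.+1 * n.+1 + 'C(n.+2, 2))%N.
  by have := pentE n.+1; have := bin2E n.+1; nia.
have -> : pent (- (n.+1)%:Z) = (n.+1 + n + (n * n + 'C(n.+1, 2)))%N.
  by have := pentE (- (n.+1)%:Z); have := bin2E n; nia.
rewrite rmorphXn rmorphN1 -exprD (exprS (-1)); ring.
Qed.

End Shanks.

Lemma pentagonal (R : comUnitRingType) n :
  eq_upto n.+1 (euler R) (\sum_(j <- zball n) (esgn j)%:~R * fpsX ^+ pent j).
Proof.
apply: eq_upto_trans (@euler_upto _ n) _; rewrite -shanks big_ord_recl.
rewrite -[X in eq_upto _ X _]addr0; apply: eq_uptoD.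
  by rewrite mul0n mul1r /qprod big_mkord bin_small // mulr1.
rewrite [X in eq_upto _ X _](_ : 0 = \sum_(i < n) 0); last by rewrite big1.
apply: eq_upto_sum => i; apply: eq_upto_sym; rewrite mulrA mulrC; apply: eq_upto_Xn0.
rewrite /= /bump /= add1n; have := bin2E i.+1; nia.
Qed.

(** The map k -> -1-k preserves the summand, so summing over integers of both signs doubles Jacobi's
    series. The range is not symmetric under this map: k = N+1 is left over, with exponent above N.
    In this form lattice maps can act on k. *)
Lemma jacobi_sym N :
  eq_upto N.+1 (2 * euler int ^+ 3)
   (\sum_(k <- zball N.+1) (esgn k * (2 * k + 1))%:~R * fpsX ^+ tri k).
Proof.
pose F k : fps int := (esgn k * (2 * k + 1))%:~R * fpsX ^+ tri k.
have FN (n : nat) : F (- n.+1%:Z) = F n.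
  rewrite /F; have -> : tri (- n.+1%:Z) = tri n.
    by have := triE (- n.+1%:Z); have := triE n; nia.
  congr (_%:~R * _); rewrite esgnN !esgn_nat exprS; lia.
have -> : \sum_(k <- zball N.+1) (esgn k * (2 * k + 1))%:~R * fpsX ^+ tri k =
    2 * \sum_(n < N.+1) F n + F N.+1.
  rewrite -[LHS]/(\sum_(k <- zball N.+1) F k).
  elim: N => [|N IHN].
    by rewrite /= !big_cons big_nil big_ord1 (FN 0%N); ring.
  by rewrite [zball _]/= 2!big_cons IHN [in RHS]big_ord_recr /= (FN N.+1); ring.
rewrite -[X in eq_upto _ X _]addr0; apply: eq_uptoD.
  apply: eq_uptoM => //; apply: eq_upto_trans (@jacobi N) _.
  apply: eq_upto_sum => n; rewrite /F tri_nat esgn_nat.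
  rewrite (_ : (2 * n + 1)%:R = 2 * n%:Z + 1 :> int) //; lia.
apply: eq_upto_sym; rewrite /F mulrC; apply: eq_upto_Xn0.
by rewrite tri_nat; have := bin2E N.+1; nia.
Qed.

(** * Sums over lattice points *)

Lemma reindex_seq (R : nmodType) (I J : eqType) (r : seq I) (s : seq J)
    (f : I -> J) (g : J -> I) (F : J -> R) :
  uniq r -> uniq s ->
  (forall i, i \in r -> f i \in s /\ g (f i) = i) ->
  (forall j, j \in s -> g j \in r /\ f (g j) = j) ->
  \sum_(j <- s) F j = \sum_(i <- r) F (f i).
Proof.
move=> r_uniq s_uniq fP gP; rewrite -(big_map f xpredT F); apply: perm_big.
apply: uniq_perm => //.
  rewrite map_inj_in_uniq // => i i' /fP[_ {2}<-] /fP[_ {2}<-] -> //.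
move=> j; apply/idP/mapP => [/gP[gj fgj]|[i /fP[fi _] ->] //].
by exists (g j).
Qed.

(** Reindexing by the involution turns the sum into its opposite. *)
Lemma sum_antisym (I : eqType) (r : seq I) (f : I -> I) (w : I -> int) :
  uniq r -> (forall x, x \in r -> f x \in r /\ f (f x) = x) ->
  (forall x, x \in r -> w (f x) = - w x) -> \sum_(x <- r) w x = 0.
Proof.
move=> r_uniq fP wf; have E := reindex_seq w r_uniq r_uniq fP fP.
suff : \sum_(x <- r) w x = - \sum_(x <- r) w x by lia.
rewrite {1}E -sumrN big_seq [RHS]big_seq; apply: eq_bigr => x; exact: wf.
Qed.

Definition zpairs n : seq (int * int) :=
  [seq (j, k) | j <- zball n, k <- zball n].

(* By mem_level the box misses no point of the level set when a and b grow at
   least linearly, as pent and tri do. *)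
Definition level (a b : int -> nat) n : seq (int * int) :=
  [seq x <- zpairs n.+1 | a x.1 + b x.2 == n]%N.

Lemma level_uniq a b n : uniq (level a b n).
Proof.
apply: filter_uniq; apply: allpairs_uniq; rewrite ?zball_uniq //.
by move=> [? ?] [? ?] _ _ [-> ->].
Qed.

Lemma le_pent j : (`|j| <= pent j)%N.
Proof. by have := pentE j; nia. Qed.

(** The successor is forced by [tri (-1)] = 0; it is also why [level] uses the box of radius n+1. *)
Lemma le_tri k : (`|k| <= (tri k).+1)%N.
Proof. by have := triE k; nia. Qed.

Lemma mem_level a b n x :
  (forall j, `|j| <= (a j).+1)%N -> (forall k, `|k| <= (b k).+1)%N ->
  (x \in level a b n) = (a x.1 + b x.2 == n)%N.
Proof.
case: x => j k lea leb; rewrite mem_filter andbC /=; apply: andb_idl => /eqP abn.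
apply/allpairsP; exists (j, k); split; rewrite ?mem_zball //=.
  by have := lea j; lia.
by have := leb k; lia.
Qed.

Lemma coefs_mul_level (f g : fps int) (a b : int -> nat) (c d : int -> int) n :
  eq_upto n.+1 f (\sum_(j <- zball n.+1) (c j)%:~R * fpsX ^+ a j) ->
  eq_upto n.+1 g (\sum_(k <- zball n.+1) (d k)%:~R * fpsX ^+ b k) ->
  coefs (f * g) n = \sum_(x <- level a b n) c x.1 * d x.2.
Proof.
move=> fE gE; rewrite (eq_uptoM fE gE) // big_distrlr /= coefs_sum.
rewrite big_filter [RHS]big_mkcond big_allpairs /=; apply: eq_bigr => j _.
rewrite coefs_sum; apply: eq_bigr => k _.
have -> : (c j)%:~R * fpsX ^+ a j * ((d k)%:~R * fpsX ^+ b k) =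
    (c j * d k)%:~R * fpsX ^+ (a j + b k) :> fps int.
  by rewrite rmorphM exprD mulrACA.
by rewrite coefs_intrM coefsXn eq_sym; case: eqP; rewrite ?mulr1 ?mulr0.
Qed.

(** * Coefficients of E^2, E^3 and E^4 in residue classes *)

Lemma euler2_level n : coefs (euler int ^+ 2) n =
  \sum_(x <- level pent pent n) esgn x.1 * esgn x.2.
Proof.
have up := @eq_upto_le _ n.+1 _ _ _ (ltnW (ltnSn n.+1)) (@pentagonal int n.+1).
exact: (coefs_mul_level up up).
Qed.

Lemma euler4_level n : 2 * coefs (euler int ^+ 4) n =
  \sum_(x <- level pent tri n) esgn x.1 * (esgn x.2 * (2 * x.2 + 1)).
Proof.
have up := @eq_upto_le _ n.+1 _ _ _ (ltnW (ltnSn n.+1)) (@pentagonal int n.+1).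
by rewrite -coefs_intrM exprS mulrCA (coefs_mul_level up (@jacobi_sym n)).
Qed.

Definition mem_level_pp n x :=
  @mem_level _ _ n x (fun j => leqW (le_pent j)) (fun j => leqW (le_pent j)).
Definition mem_level_pt n x :=
  @mem_level _ _ n x (fun j => leqW (le_pent j)) le_tri.

Lemma mod5_cases (j : int) : exists a : int,
  j = 5 * a \/ j = 5 * a + 1 \/ j = 5 * a + 2 \/ j = 5 * a + 3 \/ j = 5 * a + 4.
Proof. by exists (j %/ 5)%Z; lia. Qed.

(* With x = 6j+1 and y = 6k+1, a point of level 5m+2 has x^2 + y^2 divisible by
   5.  The Gaussian reflection x + iy -> -(x - iy)(3 + 4i)/5 is integral on the
   class x = 2y mod 5, preserves x^2 + y^2 and changes the sign. *)
Lemma euler2_sec5 m : ~~ (5 %| m)%N -> coefs (euler int ^+ 2) (5 * m + 2) = 0.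
Proof.
move=> m5; rewrite euler2_level; set n := (5 * m + 2)%N.
set L := level pent pent n.
have LP j k : ((j, k) \in L) = (j * (3 * j + 1) + k * (3 * k + 1) == (2 * n)%:Z).
  rewrite mem_level_pp /=; have := pentE j; have := pentE k; lia.
have Lu : uniq L := level_uniq _ _ _.
clearbody L; pose c (x : int * int) := (5 %| x.1 - 2 * x.2 - 1)%Z.
pose w (x : int * int) := esgn x.1 * esgn x.2.
have S0 : \sum_(x <- L | c x) w x = 0.
  pose f (x : int * int) := (- ((3 * x.1 + 4 * x.2 + 2) %/ 5)%Z,
                             ((3 * x.2 - 4 * x.1 - 1) %/ 5)%Z).
  have fE j k : c (j, k) -> exists2 t, j = 2 * k + 1 + 5 * t &
      f (j, k) = (- (2 * k + 1 + 3 * t), - k - 1 - 4 * t).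
    move=> /= /dvdzP[t] /= E; exists t; first lia.
    by rewrite /f /=; congr pair; lia.
  have fP x : x \in [seq x <- L | c x] -> f x \in [seq x <- L | c x] /\ f (f x) = x.
    case: x => j k; rewrite mem_filter LP => /andP[cx Lx].
    have [t Ej Ef] := fE j k cx; split; last first.
      rewrite Ef /f /=; congr pair; lia.
    rewrite Ef mem_filter LP /c /=; apply/andP; split; first lia.
    by move: Lx; rewrite Ej => /eqP <-; apply/eqP; ring.
  rewrite -big_filter; apply: (sum_antisym _ fP); first exact: filter_uniq.
  move=> [j k]; rewrite mem_filter => /andP[/fE[t -> ->] _]; rewrite /w /esgn /=.
  do 4 (case: ifP => //); lia.
rewrite (bigID c) /= S0 add0r -big_filter.
(* On this level x^2 + y^2 = 120m + 50, so x = 2y or y = 2x mod 5. Both together would make it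
   divisible by 25, against [m5]. Hence swapping the coordinates exchanges [c] with its
   complement. *)
have LnL x : (x \in [seq x <- L | ~~ c x]) = ((x.2, x.1) \in [seq x <- L | c x]).
  case: x => j k; rewrite !mem_filter !LP /c /= [k * _ + _]addrC.
  case: eqP; rewrite ?andbT ?andbF // => Ljk.
  have [a Ea] := mod5_cases j; have [b Eb] := mod5_cases k.
  case: Ea => [|[|[|[|]]]] Ea; case: Eb => [|[|[|[|]]]] Eb; subst j k; lia.
apply: (etrans _ S0); rewrite -[RHS]big_filter.
pose f (x : int * int) := (x.2, x.1).
apply: (etrans (reindex_seq (r := [seq x <- L | c x]) (f := f) (g := f) w _ _ _ _) _).
- exact: filter_uniq.
- exact: filter_uniq.
- by move=> [j k] xL; rewrite LnL.
- by move=> [j k]; rewrite LnL.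
by apply: eq_bigr => x _; exact: mulrC.
Qed.

Lemma mod7_cases (j : int) : exists a : int,
  j = 7 * a \/ j = 7 * a + 1 \/ j = 7 * a + 2 \/ j = 7 * a + 3 \/
  j = 7 * a + 4 \/ j = 7 * a + 5 \/ j = 7 * a + 6.
Proof. by exists (j %/ 7)%Z; lia. Qed.

(* With x = 6j+1 and y = 2k+1, a point of level 7m+1 has x^2 + 3y^2 divisible by
   7, hence x = 2y or x = -2y mod 7.  Division by 2 + sqrt(-3) in Z[sqrt(-3)]
   is, up to sign, a bijection from the first class to the points of level m. *)
Lemma euler4_sec7 m :
  (7 %| coefs (euler int ^+ 4) (7 * m + 1) + 4 * coefs (euler int ^+ 4) m)%Z.
Proof.
pose w (x : int * int) := esgn x.1 * (esgn x.2 * (2 * x.2 + 1)).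
have levelE n : 2 * coefs (euler int ^+ 4) n = \sum_(x <- level pent tri n) w x.
  exact: euler4_level.
have := levelE (7 * m + 1)%N; have := levelE m.
set n := (7 * m + 1)%N.
have levelP n' j k : ((j, k) \in level pent tri n') =
    (j * (3 * j + 1) + k * (k + 1) == (2 * n')%:Z).
  rewrite mem_level_pt /=; have := pentE j; have := triE k; lia.
have := levelP m; have := levelP n.
have := level_uniq pent tri m; have := level_uniq pent tri n.
move: (level pent tri m) (level pent tri n) => M L Lu Mu LP MP.
pose c (x : int * int) := (7 %| 6 * x.1 - 4 * x.2 - 1)%Z.
pose c' (x : int * int) := (7 %| 6 * x.1 + 4 * x.2 + 3)%Z.
pose flip (x : int * int) := (x.1, - 1 - x.2).
have wflip x : w (flip x) = w x.
  rewrite /w /flip /esgn /=; by do ?[case: ifP => ?]; lia.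
have Ec' : \sum_(x <- L | c' x) w x = \sum_(x <- L | c x) w x.
  have fP x : (x \in [seq x <- L | c' x]) = (flip x \in [seq x <- L | c x]).
    case: x => j k; rewrite !mem_filter !LP /c /c' /=.
    lia.
  have flipK x : flip (flip x) = x by case: x => j k; rewrite /flip /=; congr pair; lia.
  rewrite -big_filter -[RHS]big_filter.
  apply: (etrans (reindex_seq (r := [seq x <- L | c x]) (f := flip) (g := flip) w _ _ _ _) _).
  - exact: filter_uniq.
  - exact: filter_uniq.
  - by move=> x xL; rewrite fP flipK.
  - by move=> x; rewrite fP flipK.
  by apply: eq_bigr => x _; rewrite wflip.
have Ec : \sum_(x <- L | c x) w x = - 2 * \sum_(x <- M) w x.
  (* In the coordinates x = 6j+1 and y = 2k+1, [f] is (x, y) -> (-(2x + 3y), 2y - x), that is, x + y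
     sqrt(-3) -> -(x - y sqrt(-3))(2 + sqrt(-3)). The sign keeps the first coordinate 1 mod 6. *)
  pose f (x : int * int) := (- 2 * x.1 - x.2 - 1, - 3 * x.1 + 2 * x.2).
  pose g (x : int * int) := ((- (2 * x.1 + x.2 + 2) %/ 7)%Z,
                             (- (3 * x.1 - 2 * x.2 + 3) %/ 7)%Z).
  rewrite -big_filter (reindex_seq (r := M) (f := f) (g := g)) ?filter_uniq //.
  (* The weight of the image point is -2w + u, since its second coordinate is 2y - x; and u is odd
     under [flip], so its sum vanishes. *)
  - pose u (x : int * int) := esgn x.1 * esgn x.2 * (6 * x.1 + 1).
    have <- : - 2 * \sum_(x <- M) w x + \sum_(x <- M) u x = - 2 * \sum_(x <- M) w x.
      rewrite (_ : \sum_(x <- M) u x = 0) ?addr0 //.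
      apply: (sum_antisym (f := flip)) => // [[j k]|[j k] _].
        rewrite /flip /= !MP => /eqP <-; split; first by apply/eqP; ring.
        by congr pair; lia.
      rewrite /u /flip /esgn /=; by do ?[case: ifP => ?]; lia.
    rewrite mulr_sumr -big_split /=; apply: eq_bigr => -[j k] _.
    rewrite /w /u /f /esgn /=; by do ?[case: ifP => ?]; lia.
  - move=> [j k]; rewrite MP mem_filter LP /c /f /g /= => /eqP Ejk; split.
      by apply/andP; split; [lia|apply/eqP; rewrite /n; lia].
    by congr pair; lia.
  move=> [j k]; rewrite mem_filter LP /c /f /g /= => /andP[/dvdzP[t Et] /eqP Ejk].
  have [s Ej] : exists s, j = 3 * k - 1 + 7 * s by exists ((j - 3 * k + 1) %/ 7)%Z; lia.
  have -> : (- (2 * j + k + 2) %/ 7)%Z = - k - 2 * s by rewrite Ej; lia.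
  have -> : (- (3 * j - 2 * k + 3) %/ 7)%Z = - k - 3 * s by rewrite Ej; lia.
  split; last by congr pair; lia.
  by rewrite MP; apply/eqP; move: Ejk; rewrite /n Ej; lia.
have cov : \sum_(x <- L | ~~ c x) w x = \sum_(x <- L | c' x && ~~ c x) w x.
  rewrite big_seq_cond [RHS]big_seq_cond; apply: eq_bigl => -[j k]; rewrite LP.
  case: eqP => //= Ejk; apply/esym/andb_idl; rewrite /c /c' /=.
  have [a Ea] := mod7_cases j; have [b Eb] := mod7_cases k; rewrite /n in Ejk.
  by case: Ea => [|[|[|[|[|[|]]]]]] Ea; case: Eb => [|[|[|[|[|[|]]]]]] Eb; subst j k; lia.
(* Where the two classes meet, 7 divides y = 2k+1, a factor of the weight. *)
have both : (7 %| \sum_(x <- L | c' x && c x) w x)%Z.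
  apply: rpred_sum => -[j k]; rewrite /c /c' /w /= => /andP[? ?].
  by rewrite !dvdz_mull //; lia.
have : \sum_(x <- L | c' x) w x =
    \sum_(x <- L | c' x && c x) w x + \sum_(x <- L | c' x && ~~ c x) w x.
  by rewrite (bigID c).
have -> : \sum_(x <- L) w x = \sum_(x <- L | c x) w x + \sum_(x <- L | ~~ c x) w x.
  by rewrite (bigID c).
rewrite -cov Ec' Ec; case/dvdzP: both => z ->.
move: (\sum_(x <- M) _) (\sum_(x <- L | _) _) => sM sL; lia.
Qed.

(** Here x^2 + 3y^2 = 120m + 100 with x = 6j+1 and y = 2k+1. As -3 is not a square modulo 5, 5
    divides y, a factor of the weight. *)
Lemma euler4_sec5 m : (5 %| coefs (euler int ^+ 4) (5 * m + 4))%Z.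
Proof.
suff : (5 %| 2 * coefs (euler int ^+ 4) (5 * m + 4)%N)%Z by lia.
rewrite euler4_level big_seq; apply: rpred_sum => -[j k].
rewrite mem_level_pt /= => /eqP E; rewrite !dvdz_mull //.
have := pentE j; have := triE k.
have [a Ea] := mod5_cases j; have [b Eb] := mod5_cases k.
by case: Ea => [|[|[|[|]]]] Ea; case: Eb => [|[|[|[|]]]] Eb; subst j k; lia.
Qed.

(** Triangular numbers are 0, 1, 3 or 6 mod 7, and the class 6 occurs only when 7 divides 2i+1, the
    coefficient in Jacobi's series. *)
Lemma euler3_sec7 m M : (M \in [:: 2; 4; 5; 6])%N ->
  (7 %| coefs (euler int ^+ 3) (7 * m + M))%Z.
Proof.
move=> M_in; rewrite (@jacobi (7 * m + M)) // coefs_sum; apply: rpred_sum => i _.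
rewrite coefs_intrM coefsXn; case: eqP => [E|_]; last by rewrite mulr0 dvdz0.
rewrite mulr1 dvdz_mull //; have := bin2E i; rewrite -E.
have [a Ea] := mod7_cases i; move: M_in; rewrite !inE.
by case: Ea => [|[|[|[|[|[|]]]]]] Ea; nia.
Qed.

(** * Sections of power series and Frobenius modulo p *)

Section Substitution.
Variable R : comUnitRingType.
Implicit Types f g : fps R.

Definition fps_subst d f : fps R :=
  Fps (fun n => if (d %| n)%N then coefs f (n %/ d) else 0).

Definition fps_section d r f : fps R := Fps (fun m => coefs f (d * m + r)).

Lemma coefsMn f k n : coefs (f *+ k) n = coefs f n *+ k.
Proof. by elim: k => // k IHk; rewrite !mulrS coefsD IHk. Qed.

(** A series in q^d does not change residue classes of exponents, so it can be pulled out of the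
    section. *)
Lemma fps_section_subst d r f g : (r < d)%N ->
  fps_section d r (fps_subst d f * g) = f * fps_section d r g.
Proof.
move=> ltrd; have d_gt0 : (0 < d)%N by lia.
apply: fpsP => m; rewrite [LHS]coefsM coefsM /=.
rewrite -(big_mkord xpredT (fun i =>
  (if (d %| i)%N then coefs f (i %/ d) else 0) * coefs g (d * m + r - i))).
rewrite -(big_mkord xpredT (fun i => coefs f i * coefs g (d * (m - i) + r))).
rewrite /index_iota !subn0; set I := iota 0 (d * m + r).+1.
have IE i : (i \in I) = (i <= d * m + r)%N by rewrite mem_iota add0n ltnS.
have Iu : uniq I by apply: iota_uniq.
rewrite (bigID (dvdn d)) /= [X in _ + X]big1 ?addr0; last first.
  by move=> i /negPf->; rewrite mul0r.
rewrite -big_filter (reindex_seq (r := iota 0 m.+1) (f := muln d)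
  (g := fun i => i %/ d)%N) ?iota_uniq ?filter_uniq //.
- rewrite big_seq [RHS]big_seq; apply: eq_bigr => k; rewrite mem_iota => lekm.
  by rewrite dvdn_mulr // mulKn // mulnBr; congr (_ * coefs g _); nia.
- move=> k; rewrite mem_iota mem_filter IE dvdn_mulr // mulKn //.
  by move=> lekm; split=> //; nia.
move=> i; rewrite mem_filter IE => /andP[/dvdnP[k ->]].
by rewrite mem_iota mulnK // mulnC => lei; split=> //; nia.
Qed.

End Substitution.

Section ModP.
Variables (p : nat) (p_prime : prime p).

Lemma intr_Fp_eq0 (z : int) : (z%:~R == 0 :> 'F_p) = (p %| z)%Z.
Proof.
have N (n : nat) : (n%:R == 0 :> 'F_p) = (p %| n)%N.
  by rewrite (dvdn_pcharf (pchar_Fp p_prime)).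
case: z => n; rewrite dvdzE; first exact: N.
by rewrite NegzE rmorphN oppr_eq0 [LHS]N abszN.
Qed.

Definition fps_mod (f : fps int) : fps 'F_p := Fps (fun n => (coefs f n)%:~R).

Lemma coefs_fps_mod (f : fps int) n : coefs (fps_mod f) n = (coefs f n)%:~R.
Proof. by []. Qed.

Lemma fps_modM (f g : fps int) : fps_mod (f * g) = fps_mod f * fps_mod g.
Proof.
apply: fpsP => n /=; rewrite rmorph_sum /=.
by apply: eq_bigr => i _; rewrite rmorphM.
Qed.

Lemma fps_modX (f : fps int) n : fps_mod (f ^+ n) = fps_mod f ^+ n.
Proof.
elim: n => [|n IHn]; last by rewrite !exprS fps_modM IHn.
by rewrite !expr0; apply: fpsP => n; rewrite [LHS]/= !coefs1; case: eqP.
Qed.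

Lemma pchar_fps : p \in [pchar fps 'F_p].
Proof.
rewrite inE p_prime; apply/eqP/fpsP => n.
by rewrite coefsMn -mulr_natr (pcharf0 (pchar_Fp p_prime)) mulr0.
Qed.

Lemma fps_frobenius (f : fps 'F_p) : f ^+ p = fps_subst p f.
Proof.
apply: fpsP => m; have p_gt0 := prime_gt0 p_prime.
(* The coefficients are written as natural multiples, which the additive Frobenius morphism carries
   through unchanged. *)
have up : eq_upto m.+1 f (\sum_(i < m.+1) fpsX ^+ i *+ (coefs f i : nat)).
  move=> n ltnm; rewrite coefs_sum (bigD1 (Ordinal ltnm)) //= big1 ?addr0.
    by rewrite coefsMn coefsXn eqxx natr_Zp.
  move=> i neq; rewrite coefsMn coefsXn (_ : (n == i) = false) ?mul0rn //.
  by apply: contraNF neq => /eqP ni; apply/eqP/val_inj.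
rewrite (eq_uptoX p up) // -(pFrobenius_autE pchar_fps) rmorph_sum coefs_sum /=.
under eq_bigr => i _ do
  rewrite rmorphMn /= pFrobenius_autE -exprM coefsMn coefsXn.
case: ifP => [/dvdnP[k Em]|pm]; last first.
  apply: big1 => i _; rewrite (_ : (m == i * p)%N = false) ?mul0rn //.
  by apply: contraFF pm => /eqP->; apply: dvdn_mull.
have ltkm : (k < m.+1)%N by rewrite Em; nia.
rewrite (bigD1 (Ordinal ltkm)) //= big1 ?addr0.
  by rewrite Em mulnK // eqxx natr_Zp.
move=> i neq; rewrite (_ : (m == i * p)%N = false) ?mul0rn //.
apply: contraNF neq => /eqP mi; apply/eqP/val_inj/eqP.
by rewrite /= -(eqn_pmul2r p_gt0) -mi Em.
Qed.

End ModP.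

(** * Divisibility of the Andrews-Rose coefficients *)

(** In (a+1) 'C(a, k) = (k+1) 'C(a+1, k+1), the binomial on the left is prime to p. *)
Lemma dvdn_succ_bin p e a k : prime p ->
  ~~ (p %| 'C(a, k))%N -> (p ^ e %| k.+1 -> p ^ e %| a.+1)%N.
Proof.
move=> p_prime pC dk; have := mul_bin_diag a.+1 k; rewrite /= => E.
have cop : coprime (p ^ e) 'C(a, k) by rewrite coprimeXl // prime_coprime.
by rewrite -(Gauss_dvdl _ cop) E dvdn_mulr.
Qed.

(** The identity behind [dvdn_succ_bin] is iterated three times. As p > 3, at most one of a+1, a+2,
    a+3 is divisible by p, so that one takes the whole power. *)
Lemma dvdn_succ3_bin p e a k : prime p -> (3 < p)%N ->
  ~~ (p %| 'C(a, k))%N -> (p ^ e %| k.+3)%N ->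
  [|| p ^ e %| a.+1, p ^ e %| a.+2 | p ^ e %| a.+3]%N.
Proof.
move=> p_prime p3 pC dk.
have cop x : ~~ (p %| x)%N -> coprime (p ^ e) x.
  by move=> px; rewrite coprimeXl // prime_coprime.
have : (p ^ e %| a.+1 * a.+2 * a.+3 * 'C(a, k))%N.
  have E1 := mul_bin_diag a.+1 k; have E2 := mul_bin_diag a.+2 k.+1.
  have E3 := mul_bin_diag a.+3 k.+2; rewrite /= in E1 E2 E3.
  have -> : (a.+1 * a.+2 * a.+3 * 'C(a, k) = k.+1 * k.+2 * k.+3 * 'C(a.+3, k.+3))%N.
    rewrite -!mulnA -E3 (mulnCA k.+2) -E2 2!(mulnCA k.+1) -E1.
    by rewrite !mulnA; congr (_ * _)%N; lia.
  by rewrite -mulnA dvdn_mull // dvdn_mulr.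
rewrite Gauss_dvdl ?cop //.
have small x i : (0 < i <= 2)%N -> (p %| x -> ~~ (p %| x + i))%N.
  move=> i2 px; rewrite dvdn_addr //; apply/negP => /dvdn_leq; lia.
have [p1|p1] := boolP (p %| a.+1)%N.
  have := small _ 1 isT p1; have := small _ 2 isT p1; rewrite addn1 addn2 => n3 n2.
  by rewrite !Gauss_dvdl ?cop // => ->.
have [p2|p2] := boolP (p %| a.+2)%N.
  have := small _ 1 isT p2; rewrite addn1 => n3.
  by rewrite Gauss_dvdl ?cop // Gauss_dvdr ?cop // => ->; rewrite orbT.
by rewrite Gauss_dvdr ?coprimeMr ?cop // => ->; rewrite !orbT.
Qed.

(** [dvdn_succ_bin] applies to each of the two binomials of [dircoef], whose lower index 2t+1 has
    successor 2(t+1). *)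
Lemma dircoef_dvd_top p n t : prime p -> (p ^ 2 %| t.+1)%N ->
  (p %| dircoef n t)%Z || (p ^ 2 %| n.+1)%N || (p ^ 2 %| n)%N.
Proof.
move=> p_prime dt; have dk : (p ^ 2 %| (2 * t + 1).+1)%N.
  by rewrite (_ : (2 * t + 1).+1 = 2 * t.+1)%N ?dvdn_mull //; lia.
rewrite -orbA; apply/or3P.
have [p1|p1] := boolP (p %| 'C(n + t + 1, 2 * t + 1))%N; last first.
  apply: Or32; have := dvdn_succ_bin p_prime p1 dk.
  by rewrite (_ : (n + t + 1).+1 = n.+1 + t.+1)%N ?dvdn_addl //; lia.
have [p2|p2] := boolP (p %| 'C(n + t, 2 * t + 1))%N; last first.
  apply: Or33; have := dvdn_succ_bin p_prime p2 dk.
  by rewrite (_ : (n + t).+1 = n + t.+1)%N ?dvdn_addl //; lia.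
by apply: Or31; rewrite /dircoef dvdz_mull // dvdzE /= natz dvdn_add.
Qed.

(** [dvdn_succ3_bin] is applied to the binomial in [dircoef_bin], where 2t+1 is prime to p. In the
    middle case p^2 divides n+t+2, so p divides 2n+1 = 2(n+t+2) - (2t+3), the other factor of the
    right-hand side. *)
Lemma dircoef_dvd_mid p n t : prime p -> (3 < p)%N -> (p ^ 2 %| (2 * t).+3)%N ->
  [|| (p %| dircoef n t)%Z, p ^ 2 %| (n + t).+1 | p ^ 2 %| (n + t).+3]%N.
Proof.
move=> p_prime p3 dt; have ndvd x : (p %| x.+2 -> ~~ (p %| x))%N.
  by rewrite -addn2 => px; apply/negP => px'; move: px; rewrite dvdn_addr // => /dvdn_leq; lia.
have p_dt : (p %| (2 * t).+3)%N by apply: dvdn_trans dt; rewrite expnS dvdn_mulr.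
have nt : ~~ (p %| (2 * t).+1)%N := ndvd _ p_dt.
have E := dircoef_bin n t.
have dvdE (x : int) : ((2 * t + 1)%:R * dircoef n t = x) -> (p %| x)%Z -> (p %| dircoef n t)%Z.
  by move=> <-; rewrite natz addn1 Gauss_dvdzr // coprimezE /= prime_coprime.
have [p1|p1] := boolP (p %| 'C(n + t, 2 * t))%N.
  by rewrite (dvdE _ E) // dvdz_mull // natz.
have [->|d2|->] := or3P (dvdn_succ3_bin p_prime p3 p1 dt); rewrite ?orbT //.
rewrite (dvdE _ E) // -mulrA dvdz_mull // dvdz_mulr // natz dvdzE /=.
have d2n : (p %| 2 * (n + t).+2)%N.
  by apply: dvdn_mull; apply: dvdn_trans d2; rewrite expnS dvdn_mulr.
move: d2n; have -> : (2 * (n + t).+2 = (2 * n + 1) + (2 * t).+3)%N by lia.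
by rewrite dvdn_addl.
Qed.

(** * The congruences *)

(** Let A be the generating function modulo p. In E^(p^2) A = E^(p^2-3) (E^3 A), the factor E^3 A
    lives in class s, so a term of class r+s would need an exponent of class r in E^(p^2-3). On the
    left, the section of this class is E times that of A, and E is invertible. *)
Lemma MO_dvd p r s t n : prime p ->
  (forall k, (p %| dircoef k t)%Z \/ ('C(k.+1, 2) = s %[mod p ^ 2])%N) ->
  (forall m, (m = r %[mod p ^ 2])%N ->
     coefs (fps_mod p (euler int) ^+ (p ^ 2 - 3)) m = 0) ->
  (n = r + s %[mod p ^ 2])%N -> (p %| MO (-2) t n)%Z.
Proof.
move=> p_prime supp van nrs; rewrite -intr_Fp_eq0 //; set e := fps_mod p _ in van.
pose d := (p ^ 2)%N; pose A := fps_mod p (Fps (MO (-2) t)).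
have d3 : (3 <= d)%N by have := prime_gt1 p_prime; rewrite /d; nia.
have eA m : coefs (e ^+ 3 * A) m != 0 -> (m = s %[mod d])%N.
  rewrite -fps_modX -fps_modM coefs_fps_mod intr_Fp_eq0 // (@andrews_rose t m) // coefs_sum.
  move=> dm; apply/eqP; apply: contraNT dm => /eqP ms; apply: rpred_sum => i _.
  rewrite coefs_intrM coefsXn; case: eqP => [E|_]; last by rewrite mulr0 dvdz0.
  by rewrite mulr1 dvdz_mull //; case: (supp i) => // Ei; case: ms; rewrite E.
have ed : e ^+ d = fps_subst d e.
  rewrite /d expnS expn1 exprM !fps_frobenius //; apply: fpsP => m /=.
  case: ifP => [/dvdnP[k ->]|pm].
    rewrite mulnK ?prime_gt0 // dvdn_pmul2r ?prime_gt0 //.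
    by rewrite divnMr ?prime_gt0.
  by rewrite (_ : (p * p %| m)%N = false) //; apply: contraFF pm; apply: dvdn_trans; apply: dvdn_mulr.
have sec0 : e * fps_section d (n %% d) A = 0.
  rewrite -fps_section_subst ?ltn_mod -?ed; last by lia.
  have -> : e ^+ d = e ^+ (d - 3) * e ^+ 3 by rewrite -exprD subnK.
  apply: fpsP => m; rewrite -mulrA -[LHS]/(coefs (_ * _) (d * m + n %% d)).
  rewrite coefsM big1 // => i _.
  have [->|/eA E] := eqVneq (coefs (e ^+ 3 * A) (d * m + n %% d - i)) 0.
    by rewrite mulr0.
  rewrite van ?mul0r //; apply/eqP; rewrite -(eqn_modDr s) -nrs -/d.
  rewrite -modnDmr -E modnDmr subnKC; last by rewrite -ltnS.
  by rewrite mulnC modnMDl modn_mod.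
have Ue : e \is a GRing.unit.
  by rewrite unit_fps /= /qpoch big_ord0 coefs1 unitr1.
have /(congr1 (fun f => coefs f (n %/ d))) : fps_section d (n %% d) A = 0.
  by rewrite -[LHS](mulKr Ue) sec0 mulr0.
by rewrite /= mulnC -divn_eq => ->.
Qed.

Lemma euler22_dvd m : (m = 22 %[mod 25])%N -> coefs (fps_mod 5 (euler int) ^+ 22) m = 0.
Proof.
move=> Em; set e := fps_mod 5 _.
pose h := fps_section 5 2 (e ^+ 2).
(* By [euler2_sec5], h is itself a series in q^5, so it can be pulled out of the second section
   too. *)
have hE : h = fps_subst 5 (fps_section 5 0 h).
  apply: fpsP => k; rewrite [RHS]/=; case: ifP => [/dvdnP[j ->]|/negbT k5].
    by rewrite addn0 mulnK // mulnC.
  by rewrite -[LHS]/(coefs (e ^+ 2) (5 * k + 2)) -fps_modX coefs_fps_mod euler2_sec5.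
have -> : m = (5 * (5 * (m %/ 25) + 4) + 2)%N by lia.
rewrite -[LHS]/(coefs (fps_section 5 4 (fps_section 5 2 (e ^+ 22))) (m %/ 25)).
rewrite (exprD e 20 2) (exprM e 4 5) fps_frobenius // fps_section_subst // -/h.
rewrite hE mulrC fps_section_subst // [X in _ * X](_ : _ = 0) ?mulr0 //.
apply: fpsP => k; rewrite -[LHS]/(coefs (e ^+ 4) (5 * k + 4)).
by apply/eqP; rewrite -fps_modX coefs_fps_mod intr_Fp_eq0 // euler4_sec5.
Qed.

Lemma euler46_dvd m M : (M \in [:: 2; 4; 5; 6])%N ->
  (m = 7 * M + 1 %[mod 49])%N -> coefs (fps_mod 7 (euler int) ^+ 46) m = 0.
Proof.
move=> M_in Em; set e := fps_mod 7 _.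
have M7 : (M < 7)%N by move: M_in; rewrite !inE; lia.
have sec4 : fps_section 7 1 (e ^+ 4) = - (e ^+ 4 *+ 4).
  apply: fpsP => k; rewrite -[LHS]/(coefs (e ^+ 4) (7 * k + 1)).
  rewrite coefsN coefsMn -fps_modX !coefs_fps_mod; apply/eqP.
  rewrite -mulr_natl -addr_eq0 -(rmorphM (intr : int -> 'F_7) 4) -rmorphD.
  by rewrite intr_Fp_eq0 // euler4_sec7.
have -> : m = (7 * (7 * (m %/ 49) + M) + 1)%N by lia.
rewrite -[LHS]/(coefs (fps_section 7 1 (e ^+ 46)) (7 * (m %/ 49) + M)).
rewrite (exprD e 42 4) (exprM e 6 7) fps_frobenius // fps_section_subst // sec4.
rewrite mulrN mulrnAr -exprD (exprD e 7 3) fps_frobenius // coefsN coefsMn.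
rewrite -[X in X *+ 4]/(coefs (fps_section 7 M (fps_subst 7 e * e ^+ 3)) (m %/ 49)).
rewrite fps_section_subst // [X in _ * X](_ : _ = 0) ?mulr0 ?mul0rn ?oppr0 //.
apply: fpsP => k; rewrite -[LHS]/(coefs (e ^+ 3) (7 * k + M)).
by apply/eqP; rewrite -fps_modX coefs_fps_mod intr_Fp_eq0 // euler3_sec7.
Qed.

Theorem theorem6p5 (J N : nat) :
  [/\ (MO (-2) (25 * J + 11) (25 * N + 13) = 0 %[mod 5])%Z,
      (MO (-2) (25 * J + 24) (25 * N + 22) = 0 %[mod 5])%Z,
      (forall M : nat, M \in [:: 0%N; 1%N; 2%N; 5%N] ->
         (MO (-2) (49 * J + 23) (49 * N + 7 * M + 11) = 0 %[mod 7])%Z)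
    & (forall M : nat, M \in [:: 2%N; 4%N; 5%N; 6%N] ->
         (MO (-2) (49 * J + 48) (49 * N + 7 * M + 1) = 0 %[mod 7])%Z)].
Proof.
have cop2 p : prime p -> (2 < p)%N -> coprime (p ^ 2) 2.
  by move=> /even_prime[->//|p_odd] _; rewrite coprimeXl // coprimen2.
have top p k t : prime p -> (2 < p)%N -> (p ^ 2 %| t.+1)%N ->
    (p %| dircoef k t)%Z \/ ('C(k.+1, 2) = 0 %[mod p ^ 2])%N.
  move=> p_prime p2 dt.
  case: (boolP (p %| dircoef k t)%Z) => pd; [by left|right].
  have := dircoef_dvd_top k p_prime dt; rewrite (negPf pd) /= => dk.
  apply/eqP; rewrite mod0n -/(dvdn _ _) -(Gauss_dvdr _ (cop2 p p_prime p2)) bin2E.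
  by case/orP: dk => ?; [rewrite dvdn_mull|rewrite dvdn_mulr].
(* If 2t = -3 mod p^2 and the coefficient does not vanish mod p, then 2k+1 = 2
   or -2 mod p^2; hence 8 'C(k+1, 2) = (2k+1)^2 - 1 = 3 mod p^2. *)
have mid p k t s : prime p -> (3 < p)%N -> (p ^ 2 %| (2 * t).+3)%N ->
    (8 * s = 5 * p ^ 2 + 3)%N ->
    (p %| dircoef k t)%Z \/ ('C(k.+1, 2) = s %[mod p ^ 2])%N.
  move=> p_prime p3 dt s3.
  have cop8 : coprime (p ^ 2) 8.
    by rewrite -[8%N]/(2 ^ 3)%N coprimeXr ?cop2 // ltnW.
  case: (boolP (p %| dircoef k t)%Z) => pd; [by left|right].
  have := dircoef_dvd_mid k p_prime p3 dt; rewrite (negPf pd) /=.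
  move: (p ^ 2)%N dt s3 cop8 => d /dvdnP[u Eu] s3 cop8 dk.
  (* 4k(k+1) - 3 = (2k-1)(2k+3), and d divides a factor: 2(k+t+1) - (2t+3) = 2k-1 or 2(k+t+3) -
     (2t+3) = 2k+3. *)
  have [z Ez] : exists z : int, 4 * k%:Z * (k%:Z + 1) = d%:Z * z + 3.
    case/orP: dk => /dvdnP[v Ev].
      exists ((2 * v%:Z - u%:Z) * (2 * k%:Z + 3)).
      have -> : d%:Z * ((2 * v%:Z - u%:Z) * (2 * k%:Z + 3)) =
        (2 * (v * d)%:Z - (u * d)%:Z) * (2 * k%:Z + 3) by rewrite !PoszM; ring.
      by rewrite -Ev -Eu; lia.
    exists ((2 * v%:Z - u%:Z) * (2 * k%:Z - 1)).
    have -> : d%:Z * ((2 * v%:Z - u%:Z) * (2 * k%:Z - 1)) =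
      (2 * (v * d)%:Z - (u * d)%:Z) * (2 * k%:Z - 1) by rewrite !PoszM; ring.
    by rewrite -Ev -Eu; lia.
  apply/eqP; rewrite -eqz_nat -!modz_nat eqz_mod_dvd.
  rewrite -(@Gauss_dvdzr d 8) //; apply/dvdzP; exists (z - 5).
  have := bin2E k; nia.
have zmod (p : nat) x : (p %| x)%Z -> (x = 0 %[mod p])%Z.
  by move=> /dvdz_mod0P ->; rewrite mod0z.
split.
(* 16 is 3/8 modulo 25, and 22 + 16 = 13 mod 25. *)
- apply: zmod; apply: (@MO_dvd 5 22 16) => //.
  + by move=> k; apply: mid => //; apply/dvdnP; exists (2 * J + 1)%N; lia.
  + exact: euler22_dvd.
  + lia.
- apply: zmod; apply: (@MO_dvd 5 22 0) => //.
  + by move=> k; apply: top => //; apply/dvdnP; exists (J + 1)%N; lia.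
  + exact: euler22_dvd.
  + lia.
- move=> M M_in; apply: zmod.
  (* 31 is 3/8 modulo 49, and 7(M+4) + 1 + 31 = 7M + 11 mod 49. The shift by 4 maps 0, 1, 2, 5 to 4,
     5, 6, 2 mod 7. *)
  apply: (@MO_dvd 7 (7 * ((M + 4) %% 7) + 1) 31) => //.
  + by move=> k; apply: mid => //; apply/dvdnP; exists (2 * J + 1)%N; lia.
  + move=> m; apply: euler46_dvd.
    by move: M_in; rewrite !inE => /or4P[] /eqP->.
  + by move: M_in; rewrite !inE => /or4P[] /eqP->; lia.
move=> M M_in; apply: zmod; apply: (@MO_dvd 7 (7 * M + 1) 0) => //.
+ by move=> k; apply: top => //; apply/dvdnP; exists (J + 1)%N; lia.
+ by move=> m; apply: euler46_dvd.
+ lia.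
Qed.
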